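(* Let $f$ be a field, $L$ a Lie $f$-algebra, $T$ a representation of $L$ in an $f$-space $V$ with basis $(e_i)_{i\in I}$, $I$ linearly ordered, and let $D$ be the diagram of $T$ corresponding to this basis. Then $\Lambda^nD$ is the diagram of the representation $\Lambda^nT$ of $L$ in $\Lambda^nV=V^{\otimes n}/\mathcal{J}_n$, where $\mathcal{J}_n$ is the subspace of $V^{\otimes n}$ spanned by the tensor products $v_1\otimes\dots\otimes v_n$ ($v_i\in V$) with $v_k=v_l$ for some $k\neq l$, corresponding to the basis $(e_{i_1}\wedge\dots\wedge e_{i_n})_{(i_1<\dots<i_n)\in\Lambda^nI}$, where $e_{i_1}\wedge\dots\wedge e_{i_n}$ is the projection of $e_{i_1}\otimes\dots\otimes e_{i_n}$.
   Context: $L^\ast=\mathrm{Hom}_f(L,f)$. The diagram of a representation $T$ of $L$ corresponding to a basis $(e_i)_{i\in I}$ is the directed graph (loops allowed, no multiple edges) with vertex set $I$ having an edge $(i,j)$ iff the linear form $w(i,j)\in L^\ast$, $w(i,j)(l)=$ the coefficient of $e_j$ in $T(l)e_i$, is non-zero; the edge is then labeled by (has weight) $w(i,j)$. When there is no edge $(i,j)$, $w(i,j)=0$. A reduced weighted directed graph is one without multiple edges and with non-zero weights. For a reduced weighted directed graph $G$ with linearly ordered vertex set $V(G)$, $\Lambda^nG$ is the reduced weighted directed graph with vertex set $\Lambda^nV(G)=\{(v_1,\dots,v_n)\in V(G)^n: v_1<\dots<v_n\}$ and the following edges. For $A\in V(\Lambda^nG)$ let $v_i(A)$ be its $i$-th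 entry and $\mathrm{Pr}_i(A)\in V(\Lambda^{n-1}G)$ the sequence obtained by erasing the $i$-th entry. For $A\ne B$, the edge $(A,B)$ exists iff for some $i,j$ one has $\mathrm{Pr}_i(A)=\mathrm{Pr}_j(B)$ and there is an edge $(v_i(A),v_j(B))$ in $G$; its weight is then $(-1)^{j-i}w(v_i(A),v_j(B))$. The loop $(A,A)$ exists iff $\sum_{i\in A}w(i,i)\ne 0$ (sum over the entries of $A$), and this sum is then its weight. *)

(* Defs.v *)
From HB Require Import structures.
From mathcomp Require Import all_boot all_order all_algebra.
From mathcomp Require Import generic_quotient ring_quotient.
From mathcomp Require Import finmap boolp monalg.

Set Implicit Arguments.
Unset Strict Implicit.
Unset Printing Implicit Defensive.

Import Order.TTheory GRing.Theory.

Local Open Scope ring_scope.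
Local Open Scope quotient_scope.

Section Dual.
Context {f : fieldType} {L : lmodType f}.
Implicit Types (p q r : {scalar L}) (a b : f).

HB.instance Definition _ := gen_eqMixin {scalar L}.
HB.instance Definition _ := gen_choiceMixin {scalar L}.

Lemma scalar_ext p q : p =1 q -> p = q.
Proof.
case: p q => [p [[Hp1] [Hp2]]] [q [[Hq1] [Hq2]]] /= /funext Epq.
subst q; congr GRing.Linear.Pack.
by rewrite (Prop_irrelevance Hp1 Hq1) (Prop_irrelevance Hp2 Hq2).
Qed.

Definition scalar_zero : L -> f := fun=> 0.
Definition scalar_opp p : L -> f := fun l => - p l.
Definition scalar_add p q : L -> f := fun l => p l + q l.
Definition scalar_scale a p : L -> f := fun l => a * p l.

Fact scalar_zero_linear : linear_for *%R scalar_zero.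
Proof. by move=> a x y; rewrite /scalar_zero mulr0 addr0. Qed.
HB.instance Definition _ :=
  GRing.isLinear.Build f L f *%R scalar_zero scalar_zero_linear.

Fact scalar_opp_linear p : linear_for *%R (scalar_opp p).
Proof. by move=> a x y; rewrite /scalar_opp linearP opprD mulrN. Qed.
HB.instance Definition _ p :=
  GRing.isLinear.Build f L f *%R (scalar_opp p) (scalar_opp_linear p).

Fact scalar_add_linear p q : linear_for *%R (scalar_add p q).
Proof. by move=> a x y; rewrite /scalar_add !linearP mulrDr addrACA. Qed.
HB.instance Definition _ p q :=
  GRing.isLinear.Build f L f *%R (scalar_add p q) (scalar_add_linear p q).

Fact scalar_scale_linear a p : linear_for *%R (scalar_scale a p).
Proof. by move=> b x y; rewrite /scalar_scale linearP mulrDr mulrCA. Qed.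
HB.instance Definition _ a p :=
  GRing.isLinear.Build f L f *%R (scalar_scale a p) (scalar_scale_linear a p).

Fact scalar_addA : associative (fun p q => scalar_add p q : {scalar L}).
Proof. by move=> p q r; apply: scalar_ext => l; apply: addrA. Qed.
Fact scalar_addC : commutative (fun p q => scalar_add p q : {scalar L}).
Proof. by move=> p q; apply: scalar_ext => l; apply: addrC. Qed.
Fact scalar_add0 :
  left_id (scalar_zero : {scalar L}) (fun p q => scalar_add p q : {scalar L}).
Proof. by move=> p; apply: scalar_ext => l; apply: add0r. Qed.
Fact scalar_addN :
  left_inverse (scalar_zero : {scalar L}) (fun p => scalar_opp p : {scalar L})
    (fun p q => scalar_add p q : {scalar L}).
Proof. by move=> p; apply: scalar_ext => l; apply: addNr. Qed.

HB.instance Definition _ := GRing.isZmodule.Build {scalar L}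
  scalar_addA scalar_addC scalar_add0 scalar_addN.

Fact scalar_scaleA a b p :
  scalar_scale a (scalar_scale b p) = scalar_scale (a * b) p :> {scalar L}.
Proof. by apply: scalar_ext => l; apply: mulrA. Qed.
Fact scalar_scale1 : left_id 1 (fun a p => scalar_scale a p : {scalar L}).
Proof. by move=> p; apply: scalar_ext => l; apply: mul1r. Qed.
Fact scalar_scaleDr :
  right_distributive (fun a p => scalar_scale a p : {scalar L}) +%R.
Proof. by move=> a p q; apply: scalar_ext => l; apply: mulrDr. Qed.
Fact scalar_scaleDl p :
  {morph (fun a => scalar_scale a p : {scalar L}) : a b / a + b}.
Proof. by move=> a b; apply: scalar_ext => l; apply: mulrDl. Qed.

HB.instance Definition _ := GRing.Zmodule_isLmodule.Build f {scalar L}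
  scalar_scaleA scalar_scale1 scalar_scaleDr scalar_scaleDl.

End Dual.

Inductive span (f : fieldType) (V : lmodType f) (S : V -> Prop) : V -> Prop :=
| span0 : span S 0
| spanD a s u : S s -> span S u -> span S (a *: s + u).

Section Span.
Context {f : fieldType} {V : lmodType f} (S : V -> Prop).

Lemma span_gen s : S s -> span S s.
Proof. by move=> Ss; rewrite -[s]addr0 -[s]scale1r; apply: spanD => //; constructor. Qed.

Lemma span_add u v : span S u -> span S v -> span S (u + v).
Proof.
move=> Su Sv; elim: Su => [|a s u' Ss _ IH]; first by rewrite add0r.
by rewrite -addrA; apply: spanD.
Qed.

Lemma span_scale a u : span S u -> span S (a *: u).
Proof.
elim=> [|b s u' Ss _ IH]; first by rewrite scaler0; constructor.
by rewrite scalerDr scalerA; apply: spanD.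
Qed.

Lemma span_sum (I : Type) (r : seq I) (F : I -> V) :
  (forall i, span S (F i)) -> span S (\sum_(i <- r) F i).
Proof. by move=> SF; elim/big_rec: _ => [|i u _ Su]; [constructor|apply: span_add]. Qed.

End Span.

Section Basis.
Context {f : fieldType} {V : lmodType f} {I : eqType}.
Implicit Types (e : I -> V) (c : I -> f) (u v : V).

Definition lin_indep e : Prop :=
  forall (s : seq I) c, uniq s -> \sum_(i <- s) c i *: e i = 0 ->
  {in s, forall i, c i = 0}.

Definition generates e : Prop := forall v, span (fun u => exists i, u = e i) v.

Definition is_basis e : Prop := lin_indep e /\ generates e.

Definition is_coords e v c : Prop :=
  exists s : seq I, [/\ uniq s, forall i, i \notin s -> c i = 0 &
    v = \sum_(i <- s) c i *: e i].

Lemma is_coords_widen e v c (s r : seq I) :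
  uniq s -> uniq r -> {subset s <= r} -> (forall i, i \notin s -> c i = 0) ->
  v = \sum_(i <- s) c i *: e i -> v = \sum_(i <- r) c i *: e i.
Proof.
move=> us ur sr c0 ->; rewrite [RHS](bigID (mem s)) /= [X in _ = _ + X]big1 ?addr0.
  rewrite -[RHS]big_filter; apply: perm_big; apply: uniq_perm; rewrite ?filter_uniq //.
  by move=> i; rewrite mem_filter; case: (boolP (i \in s)) => [/sr ->|].
by move=> i /c0 ->; rewrite scale0r.
Qed.

Lemma is_coordsP e v w c d a : is_coords e v c -> is_coords e w d ->
  is_coords e (a *: v + w) (fun i => a * c i + d i).
Proof.
move=> [s [us s0 sE]] [r [ur r0 rE]]; exists (undup (s ++ r)); split.
- exact: undup_uniq.
- move=> i; rewrite mem_undup mem_cat negb_or => /andP[/s0 -> /r0 ->].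
  by rewrite mulr0 addr0.
have sub x : x \in [:: s; r] -> {subset x <= undup (s ++ r)}.
  by rewrite !inE => /orP[] /eqP -> i ix; rewrite mem_undup mem_cat ix ?orbT.
rewrite (is_coords_widen us (undup_uniq _) (sub _ (mem_head _ _)) s0 sE).
rewrite (is_coords_widen ur (undup_uniq _) (sub r _) r0 rE) ?inE ?eqxx ?orbT //.
rewrite scaler_sumr -big_split /=; apply: eq_bigr => i _.
by rewrite scalerDl scalerA.
Qed.

Lemma is_coords_ex e : generates e -> forall v, exists c, is_coords e v c.
Proof.
move=> ge v; elim: {v}(ge v) => [|a _ u [i ->] _ [c cu]].
  by exists (fun=> 0), [::]; split=> //; rewrite big_nil.
exists (fun j => a * (i == j)%:R + c j); apply: is_coordsP => //.
exists [:: i]; split=> // [j|]; rewrite ?inE ?big_seq1 ?eqxx ?scale1r //.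
by rewrite eq_sym => /negPf ->.
Qed.

Lemma is_coords_uniq e v c d :
  lin_indep e -> is_coords e v c -> is_coords e v d -> c = d.
Proof.
move=> ie cv dv; apply: funext => i.
have [s [us s0 sE]] := is_coordsP (-1) cv dv.
have {}sE : \sum_(j <- s) (-1 * c j + d j) *: e j = 0.
  by rewrite -sE scaleN1r addNr.
apply/esym/eqP; rewrite -subr_eq0 addrC -mulN1r; apply/eqP.
by have [/(ie _ _ us sE)|/s0] := boolP (i \in s).
Qed.

(* Well defined by is_coords_uniq. *)
Definition coef e (He : is_basis e) v : I -> f :=
  sval (cid (is_coords_ex He.2 v)).

Lemma coefP e (He : is_basis e) v : is_coords e v (coef He v).
Proof. exact: (svalP (cid (is_coords_ex He.2 v))). Qed.

Lemma coef_linear e (He : is_basis e) j : linear_for *%R (fun v => coef He v j).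
Proof.
move=> a u v; have := is_coordsP a (coefP He u) (coefP He v).
by move=> /(is_coords_uniq He.1 (coefP He _)) ->.
Qed.

End Basis.

HB.mixin Record isLieAlgebra (f : fieldType) L of GRing.Lmodule f L := {
  bracket : L -> L -> L;
  bracket_linearl : forall y, linear (fun x => bracket x y);
  bracket_linearr : forall x, linear (bracket x);
  bracketxx : forall x, bracket x x = 0;
  bracket_jacobi : forall x y z,
    bracket x (bracket y z) + bracket y (bracket z x) + bracket z (bracket x y) = 0
}.

#[short(type="lieAlgType")]
HB.structure Definition LieAlgebra (f : fieldType) :=
  {L of isLieAlgebra f L & GRing.Lmodule f L}.

Record representation (f : fieldType) (L : lieAlgType f) (V : lmodType f) :=
  Representation {
    rep_op :> L -> V -> V;
    rep_linear : forall l, linear (rep_op l);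
    rep_linearl : forall v, linear (fun l => rep_op l v);
    rep_bracket : forall x y v,
      rep_op (bracket x y) v = rep_op x (rep_op y v) - rep_op y (rep_op x v)
  }.

Section QuotientSpace.
Context {f : fieldType} {V : lmodType f} (S : V -> Prop).

Definition span_pred : {pred V} := fun v => `[< span S v >].

Fact span_pred_closed : zmod_closed span_pred.
Proof.
split=> [|u v /asboolP Su /asboolP Sv]; apply/asboolP; first exact: span0.
by rewrite -scaleN1r; apply: span_add Su _; apply: span_scale.
Qed.
HB.instance Definition _ := GRing.isZmodClosed.Build V span_pred span_pred_closed.

(* The quotient of V by the subspace spanned by S. *)
Definition qspace : Type := Quotient.quot span_pred.
HB.instance Definition _ := GRing.Zmodule.on qspace.

Definition qproj (v : V) : qspace := \pi_(Quotient.quot span_pred) v.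
Definition qrepr (x : qspace) : V := repr (x : Quotient.quot span_pred).

Lemma qreprK : cancel qrepr qproj.
Proof. exact: reprK. Qed.

Lemma qproj_eq u v : qproj u = qproj v <-> span S (u - v).
Proof.
have E : (span_pred (u - v)) = (u == v %[mod Quotient.quot span_pred]).
  exact: Quotient.idealrBE.
split; first by move=> uv; apply/asboolP; rewrite -/(span_pred _) E; apply/eqP.
by move=> /asboolP; rewrite -/(span_pred _) E => /eqP.
Qed.

Lemma qprojB u v : qproj (u - v) = qproj u - qproj v.
Proof. exact: (raddfB (\pi_(Quotient.quot span_pred))). Qed.

Definition qscale (a : f) (x : qspace) : qspace := qproj (a *: qrepr x).

Lemma qscaleE a v : qscale a (qproj v) = qproj (a *: v).
Proof.
apply/qproj_eq; rewrite -scalerBr; apply: span_scale.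
by apply/qproj_eq; rewrite qreprK.
Qed.

Lemma qprojD u v : qproj (u + v) = qproj u + qproj v.
Proof. exact: (raddfD (\pi_(Quotient.quot span_pred))). Qed.

Fact qscaleA a b x : qscale a (qscale b x) = qscale (a * b) x.
Proof. by rewrite -[x]qreprK !qscaleE scalerA. Qed.
Fact qscale1 : left_id 1 qscale.
Proof. by move=> x; rewrite -[x]qreprK qscaleE scale1r. Qed.
Fact qscaleDr : right_distributive qscale +%R.
Proof.
by move=> a x y; rewrite -[x]qreprK -[y]qreprK -qprojD !qscaleE scalerDr qprojD.
Qed.
Fact qscaleDl x : {morph qscale^~ x : a b / a + b}.
Proof. by move=> a b; rewrite -[x]qreprK !qscaleE scalerDl qprojD. Qed.
HB.instance Definition _ := GRing.Zmodule_isLmodule.Build f qspace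
  qscaleA qscale1 qscaleDr qscaleDl.

Fact qproj_linear : linear qproj.
Proof. by move=> a u v; rewrite qprojD -qscaleE. Qed.
HB.instance Definition _ := GRing.isLinear.Build f V qspace *:%R qproj qproj_linear.

Lemma qproj_gen s : S s -> qproj s = 0.
Proof.
by move=> Ss; rewrite -[RHS](raddf0 qproj); apply/qproj_eq; rewrite subr0; apply: span_gen.
Qed.

Section Lift.
Context {W : lmodType f} (F : {linear V -> W}).
Hypothesis F0 : forall s, S s -> F s = 0.

(* F0 occurs so that linearity, which depends on it, can be a canonical instance. *)
Definition qlift : qspace -> W := let _ := F0 in fun x => F (qrepr x).

Lemma qliftE v : qlift (qproj v) = F v.
Proof.
have F0' u : span S u -> F u = 0.
  by elim=> [|a s w /F0 Fs _ Fw]; rewrite ?raddf0 // linearP Fs Fw scaler0 addr0.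
apply/eqP; rewrite -subr_eq0; apply/eqP; rewrite -[LHS](raddfB F); apply: F0'.
by apply/qproj_eq; rewrite qreprK.
Qed.

Fact qlift_linear : linear qlift.
Proof.
move=> a x y; rewrite -[x]qreprK -[y]qreprK -linearP !qliftE.
exact: linearP.
Qed.
HB.instance Definition _ :=
  GRing.isLinear.Build f qspace W *:%R qlift qlift_linear.

End Lift.

Lemma qspace_ind (P : qspace -> Prop) : (forall v, P (qproj v)) -> forall x, P x.
Proof. by move=> Pv x; rewrite -[x]qreprK. Qed.

End QuotientSpace.

Section FreeSpace.
Context {f : fieldType} {K : choiceType} {W : lmodType f} (phi : K -> W).

Definition free_lift (g : {malg f[K]}) : W := \sum_(k <- msupp g) g@_k *: phi k.

Lemma free_liftEw (g : {malg f[K]}) (s : seq K) : uniq s ->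
  {subset msupp g <= s} -> free_lift g = \sum_(k <- s) g@_k *: phi k.
Proof.
move=> us gs; rewrite [RHS](bigID (mem (msupp g))) /= [X in _ = _ + X]big1 ?addr0.
  rewrite -[RHS]big_filter; apply: perm_big; apply: uniq_perm.
  - exact: finmap.fset_uniq.
  - exact: filter_uniq.
  by move=> i; rewrite mem_filter; case: (boolP (i \in msupp g)) => [/gs ->|].
by move=> k /mcoeff_outdom ->; rewrite scale0r.
Qed.

Fact free_lift_linear : linear free_lift.
Proof.
move=> a g h; pose s := undup (msupp (a *: g + h) ++ msupp g ++ msupp h).
have us : uniq s by exact: undup_uniq.
rewrite !(@free_liftEw _ s us).
- rewrite scaler_sumr -big_split /=; apply: eq_bigr => k _.
  by rewrite mcoeffD mcoeffZ scalerDl scalerA.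
all: by move=> k; rewrite mem_undup !mem_cat => ->; rewrite ?orbT.
Qed.
HB.instance Definition _ :=
  GRing.isLinear.Build f {malg f[K]} W *:%R free_lift free_lift_linear.

Lemma free_liftU k : free_lift << k >> = phi k.
Proof.
rewrite (@free_liftEw _ [:: k]) ?big_seq1 ?mcoeffUU ?scale1r //.
by move=> i; rewrite msuppU oner_eq0 finmap.in_fset1 inE.
Qed.

End FreeSpace.

Lemma free_ind (f : fieldType) (K : choiceType) (P : {malg f[K]} -> Prop) :
  P 0 -> (forall a k g, P g -> P (a *: << k >> + g)) -> forall g, P g.
Proof.
move=> P0 PD g; rewrite [g]monalgE.
elim: (finmap.enum_fset (msupp g)) => [|k s IH]; first by rewrite big_nil.
rewrite big_cons; have -> : << g@_k *g k >> = g@_k *: << k >> :> {malg f[K]}.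
  by apply/malgP => j; rewrite mcoeffZ !mcoeffU mulr_natr.
exact: PD.
Qed.

Section Powers.
Context {f : fieldType}.

Section Def.
Context (n : nat) (V : lmodType f).
Implicit Types (t : {ffun 'I_n -> V}) (u v : V) (k l : 'I_n) (a : f).

Definition upd t k u : {ffun 'I_n -> V} := [ffun i => if i == k then u else t i].

Definition multilin_rel (x : {malg f[{ffun 'I_n -> V}]}) : Prop :=
  exists t k a u v,
    x = << upd t k (a *: u + v) >> - a *: << upd t k u >> - << upd t k v >>.

(* {malg f[K]} is used only as the f-space with basis K: the n-fold tensor power
   is the free space on V^n modulo the relations of multilinearity. *)
Definition tensor_power : Type := qspace multilin_rel.
HB.instance Definition _ := GRing.Lmodule.on tensor_power.

Definition tensor t : tensor_power := qproj multilin_rel << t >>.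

Definition alternating_rel (x : tensor_power) : Prop :=
  exists t k l, [/\ k != l, t k = t l & x = tensor t].

(* V^{(x)n} / J_n, where J_n is the span of the pure tensors with a repeated
   factor. *)
Definition ext_power : Type := qspace alternating_rel.
HB.instance Definition _ := GRing.Lmodule.on ext_power.

Definition wedge t : ext_power := qproj alternating_rel (tensor t).

Lemma updE t k u i : upd t k u i = if i == k then u else t i.
Proof. by rewrite ffunE. Qed.

Lemma upd_upd t k u v : upd (upd t k u) k v = upd t k v.
Proof. by apply/ffunP => i; rewrite !updE; case: eqP. Qed.

Lemma upd_updC t k l u v : k != l -> upd (upd t k u) l v = upd (upd t l v) k u.
Proof.
move=> kl; apply/ffunP => i; rewrite !updE; case: eqP => // ->.
by rewrite eq_sym (negPf kl).
Qed.

Lemma upd_id t k : upd t k (t k) = t.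
Proof. by apply/ffunP => i; rewrite !updE; case: eqP => // ->. Qed.

Lemma tensorP t k a u v : tensor (upd t k (a *: u + v)) =
  a *: tensor (upd t k u) + tensor (upd t k v).
Proof.
rewrite /tensor -linearP; apply/qproj_eq; rewrite opprD addrA.
by apply: span_gen; exists t, k, a, u, v.
Qed.

Lemma wedge_alt t k l : k != l -> t k = t l -> wedge t = 0.
Proof. by move=> kl tkl; apply: qproj_gen; exists t, k, l. Qed.

Lemma wedgeP t k a u v : wedge (upd t k (a *: u + v)) =
  a *: wedge (upd t k u) + wedge (upd t k v).
Proof. by rewrite /wedge tensorP linearP. Qed.

Lemma wedge_swap t k l u v : k != l ->
  wedge (upd (upd t k u) l v) + wedge (upd (upd t k v) l u) = 0.
Proof.
move=> kl; pose w x y := wedge (upd (upd t k x) l y).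
have w_alt x : w x x = 0 by apply: (wedge_alt kl); rewrite !updE !eqxx (negPf kl).
have wDr x y z : w x (y + z) = w x y + w x z.
  by rewrite -[y]scale1r /w wedgeP !scale1r.
have wDl x y z : w (x + y) z = w x z + w y z.
  by rewrite /w ![upd (upd t k _) l _]upd_updC // -[x]scale1r wedgeP !scale1r.
by have := w_alt (u + v); rewrite wDl !wDr !w_alt add0r addr0.
Qed.

Lemma ext_power_ind (P : ext_power -> Prop) : P 0 ->
  (forall a t x, P x -> P (a *: wedge t + x)) -> forall x, P x.
Proof.
move=> P0 PD; apply: qspace_ind; apply: qspace_ind.
apply: free_ind => [|a t g IH]; first by rewrite !raddf0.
by rewrite !linearP; apply: PD.
Qed.

End Def.

Section Operators.
Context {n : nat} {V : lmodType f} (A : {linear V -> V}).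
Implicit Types (t : {ffun 'I_n -> V}).

Definition leibniz t : tensor_power n V := \sum_k tensor (upd t k (A (t k))).

Fact leibniz_multilin x : multilin_rel x -> free_lift leibniz x = 0.
Proof.
move=> [t [k [a [u [v ->]]]]]; rewrite !raddfB /= linearZ /= !free_liftU /leibniz.
apply/eqP; rewrite -addrA -opprD subr_eq0; apply/eqP.
rewrite scaler_sumr -big_split; apply: eq_bigr => j _ /=.
rewrite !updE; case: (altP (j =P k)) => [->|jk].
  by rewrite !upd_upd linearP tensorP.
by rewrite ![upd (upd t k _) j _]upd_updC 1?eq_sym // tensorP.
Qed.

(* An element of a Lie algebra acts on a tensor product of representations by
   the Leibniz rule:
   v_1 (x) ... (x) v_n |-> sum_k v_1 (x) ... (x) A v_k (x) ... (x) v_n. *)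
Definition tensor_op : tensor_power n V -> tensor_power n V :=
  qlift leibniz_multilin.
HB.instance Definition _ := GRing.Linear.on tensor_op.

Lemma tensor_opE t : tensor_op (tensor t) = \sum_k tensor (upd t k (A (t k))).
Proof. by rewrite /tensor_op qliftE /= free_liftU. Qed.

Fact tensor_op_alt x :
  alternating_rel x -> (qproj (@alternating_rel n V) \o tensor_op) x = 0.
Proof.
move=> [t [k [l [kl tkl ->]]]]; rewrite /= tensor_opE raddf_sum /=.
have lk : l != k by rewrite eq_sym.
rewrite (bigD1 k) //= (bigD1 l) //= big1 => [|j /andP[jk jl]]; last first.
  apply: (@wedge_alt _ _ _ k l kl).
  by rewrite !updE ![_ == j]eq_sym (negPf jk) (negPf jl).
have e1 w : upd t k w = upd (upd t k w) l (t k).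
  by rewrite upd_updC // tkl upd_id.
have e2 w : upd t l w = upd (upd t k (t k)) l w by rewrite upd_id.
rewrite addr0 -/(wedge _) -/(wedge (upd t l _)) -tkl e1 e2.
exact: wedge_swap.
Qed.

Definition ext_op : ext_power n V -> ext_power n V := qlift tensor_op_alt.
HB.instance Definition _ := GRing.Linear.on ext_op.

Lemma ext_opE t : ext_op (wedge t) = \sum_k wedge (upd t k (A (t k))).
Proof. by rewrite /ext_op qliftE /= tensor_opE raddf_sum. Qed.

End Operators.

Section ExtRepresentation.
Context {L : lieAlgType f} {V : lmodType f} (T : representation L V) (n : nat).

HB.instance Definition _ (l : L) :=
  GRing.isLinear.Build f V V *:%R (T l) (rep_linear T l).

Let ext_opP l a u x : ext_op (n := n) (T l) (a *: u + x) =
  a *: ext_op (T l) u + ext_op (T l) x.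
Proof. exact: linearP. Qed.

Definition ext_rep_op (l : L) : ext_power n V -> ext_power n V := ext_op (T l).

Fact ext_rep_linear l : linear (ext_rep_op l).
Proof. exact: linearP. Qed.

Fact ext_rep_linearl x : linear (fun l => ext_rep_op l x).
Proof.
move=> a l m; rewrite /ext_rep_op; elim/ext_power_ind: x => [|b t x IH].
  by rewrite !raddf0 addr0.
rewrite !ext_opP IH [a *: (_ + _)]scalerDr scalerA mulrC -scalerA.
rewrite [RHS]addrACA -scalerDr !ext_opE.
congr (_ *: _ + _); rewrite scaler_sumr -big_split; apply: eq_bigr => k _ /=.
by rewrite (rep_linearl T (t k)) wedgeP.
Qed.

Fact ext_rep_bracket l m x : ext_rep_op (bracket l m) x =
  ext_rep_op l (ext_rep_op m x) - ext_rep_op m (ext_rep_op l x).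
Proof.
rewrite /ext_rep_op; elim/ext_power_ind: x => [|b t x IH].
  by rewrite !raddf0 addr0.
suff wedge_case : ext_op (T (bracket l m)) (wedge t) =
    ext_op (T l) (ext_op (T m) (wedge t)) - ext_op (T m) (ext_op (T l) (wedge t)).
  move: (wedge t) wedge_case => w wedge_case.
  by rewrite !ext_opP IH wedge_case opprD [RHS]addrACA -scalerBr.
have opop (p q : L) : ext_op (T p) (ext_op (T q) (wedge t)) =
    \sum_k (wedge (upd t k (T p (T q (t k)))) +
      \sum_(j | j != k) wedge (upd (upd t k (T q (t k))) j (T p (t j)))).
  rewrite ext_opE raddf_sum; apply: eq_bigr => k _ /=.
  rewrite ext_opE (bigD1 k) //= updE eqxx upd_upd; congr (_ + _).
  by apply: eq_bigr => j jk; rewrite updE (negPf jk).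
rewrite !opop !big_split /= opprD addrACA [X in _ + X](_ : _ = 0).
  rewrite addr0 -sumrB ext_opE; apply: eq_bigr => k _.
  transitivity (wedge (upd t k (-1 *: T m (T l (t k)) + T l (T m (t k))))).
    by congr (wedge (upd t k _)); rewrite scaleN1r addrC; exact: rep_bracket.
  by rewrite wedgeP scaleN1r addrC.
apply/eqP; rewrite subr_eq0; apply/eqP.
rewrite (exchange_big_dep predT) //=; apply: eq_bigr => k _.
apply: eq_big => [j|j jk]; first by rewrite eq_sym.
by rewrite upd_updC // eq_sym.
Qed.

Definition ext_rep : representation L (ext_power n V) :=
  Representation ext_rep_linear ext_rep_linearl ext_rep_bracket.

Lemma ext_repE l t : ext_rep l (wedge t) = \sum_k wedge (upd t k (T l (t k))).
Proof. exact: ext_opE. Qed.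

End ExtRepresentation.
End Powers.

(* Reduced weighted directed graphs: no multiple edges, loops allowed, non-zero
   weights on the edges. The weight of a pair that is not an edge is 0 by
   convention. *)
Record wdigraph (f : fieldType) (M : lmodType f) (X : Type) := WDigraph {
  edge : rel X;
  weight : X -> X -> M;
  edgeE : forall x y, edge x y = (weight x y != 0)
}.

Section Diagram.
Context {f : fieldType} {L : lieAlgType f} {V : lmodType f} {I : eqType}.
Context {e : I -> V} (He : is_basis e) (T : representation L V).

Definition diagram_weight (i j : I) : L -> f := fun l => coef He (T l (e i)) j.

Fact diagram_weight_linear i j : linear_for *%R (diagram_weight i j).
Proof.
by move=> a l m; rewrite /diagram_weight (rep_linearl T (e i)) coef_linear.
Qed.
HB.instance Definition _ i j := GRing.isLinear.Build f L f *%R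
  (diagram_weight i j) (diagram_weight_linear i j).

Definition diagram : wdigraph {scalar L} I :=
  @WDigraph f {scalar L} I (fun i j => (diagram_weight i j : {scalar L}) != 0)
    diagram_weight (fun _ _ => erefl).

End Diagram.

Section ExtVertices.
Context {d : Order.disp_t} {X : orderType d} {n : nat}.

Definition ext_vertex : Type := {A : n.-tuple X | sorted <%O A}.
HB.instance Definition _ := Choice.on ext_vertex.

Definition entry (A : ext_vertex) (i : 'I_n) : X := tnth (val A) i.

Lemma entry_lt (A : ext_vertex) (i j : 'I_n) : (i < j)%N -> (entry A i < entry A j)%O.
Proof.
move=> ij; rewrite /entry !(tnth_nth (entry A i)).
by rewrite (lt_sorted_ltn_nth (entry A i) (valP A)) ?inE ?size_tuple ?ltn_ord.
Qed.

End ExtVertices.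
Arguments ext_vertex {d} X n.

Section Erase.
Context {d : Order.disp_t} {X : orderType d} {n : nat}.
Implicit Types (A B : ext_vertex X n) (i j : 'I_n).

Fact erase_sorted i A : sorted <%O [tuple entry A (lift i k) | k < n.-1].
Proof.
rewrite sorted_map; apply: (@sub_sorted _ (relpre val ltn)).
  by move=> k l kl; apply: entry_lt; rewrite ltnNge /= leq_bump2 -ltnNge.
by rewrite -sorted_map val_enum_ord; apply: iota_ltn_sorted.
Qed.

Definition erase i A : ext_vertex X n.-1 :=
  exist (fun B : n.-1.-tuple X => sorted <%O B) _ (erase_sorted i A).

Lemma entry_erase i A k : entry (erase i A) k = entry A (lift i k).
Proof. by rewrite /entry tnth_mktuple. Qed.

Lemma entry_inj A : injective (entry A).
Proof.
move=> i j; case: (ltngtP i j) => [/(entry_lt A)|/(entry_lt A)|/val_inj //].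
  by move=> + E; rewrite E ltxx.
by move=> + E; rewrite E ltxx.
Qed.

Lemma erase_sub i A : {subset val (erase i A) <= val A}.
Proof.
by move=> x /tnthP[k ->]; rewrite -/(entry _ k) entry_erase; apply: mem_tnth.
Qed.

Lemma mem_erase i k A : k != i -> entry A k \in val (erase i A).
Proof.
rewrite eq_sym => /unlift_some[m -> _].
by rewrite -entry_erase; apply: mem_tnth.
Qed.

Let erase_injl A B i j i' j' : A != B ->
  erase i A = erase j B -> erase i' A = erase j' B -> i = i'.
Proof.
move=> AB E E'; apply/eqP; apply: contraNT AB => ii'.
have sub : {subset val A <= val B}.
  move=> x /tnthP[k ->]; case: (altP (k =P i)) => [->|ki].
    by apply: (@erase_sub j'); rewrite -E'; apply: mem_erase.
  by apply: (@erase_sub j); rewrite -E; apply: mem_erase.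
have uA : uniq (val A) by apply: lt_sorted_uniq (valP A).
have [|_ eqi] := uniq_min_size uA sub; first by rewrite !size_tuple.
by apply/eqP; do 2 apply: val_inj; apply: lt_sorted_eq (valP A) (valP B) eqi.
Qed.

Lemma erase_inj A B i j i' j' : A != B ->
  erase i A = erase j B -> erase i' A = erase j' B -> i = i' /\ j = j'.
Proof.
move=> AB E E'; split; first exact: erase_injl AB E E'.
by apply: erase_injl (esym E) (esym E'); rewrite eq_sym.
Qed.

End Erase.

Section ExtGraph.
Context {f : fieldType} {M : lmodType f} {d : Order.disp_t} {X : orderType d}.
Context (n : nat) (G : wdigraph M X).
Implicit Types (A B : ext_vertex X n).

Definition ext_adj A B (ij : 'I_n * 'I_n) : bool :=
  (erase ij.1 A == erase ij.2 B) && edge G (entry A ij.1) (entry B ij.2).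

Definition loop_weight A : M := \sum_(i < n) weight G (entry A i) (entry A i).

Definition ext_edge A B : bool :=
  if A == B then loop_weight A != 0 else [exists ij, ext_adj A B ij].

(* By erase_inj the pair (i, j) is unique, so that the choice is immaterial.
   Indices start at 0, which does not affect j - i. *)
Definition ext_weight A B : M :=
  if A == B then loop_weight A
  else if [pick ij | ext_adj A B ij] is Some (i, j)
    then ((-1) ^ (j%:Z - i%:Z)) *: weight G (entry A i) (entry B j)
    else 0.

Fact ext_edgeE A B : ext_edge A B = (ext_weight A B != 0).
Proof.
rewrite /ext_edge /ext_weight; case: eqP => // _.
case: pickP => [[i j] adj|noadj].
  have /andP[/= _ ] := adj; rewrite edgeE => w0.
  rewrite scaler_eq0 negb_or w0 expfz_neq0 ?oppr_eq0 ?oner_eq0 //=.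
  by apply/existsP; exists (i, j).
by rewrite eqxx; apply/existsP => -[ij]; rewrite noadj.
Qed.

Definition ext_graph : wdigraph M (ext_vertex X n) := WDigraph ext_edgeE.

End ExtGraph.

Definition wedge_family (f : fieldType) (V : lmodType f) (d : Order.disp_t)
    (I : orderType d) (e : I -> V) (n : nat) (A : ext_vertex I n) : ext_power n V :=
  wedge [ffun i => e (entry A i)].

(* Main.v *)
Require Import Defs.
From HB Require Import structures.
From mathcomp Require Import all_boot all_order all_algebra.
From mathcomp Require Import all_fingroup boolp monalg.

(** The determinants of the coordinates of [v_1, ..., v_n] on the increasing
    sequences [B] of indices define linear forms on the exterior power that are
    dual to the family of the [e_A]; so this family, which is clearly
    generating, is a basis, and these forms are the coordinates.  Expanding the
    determinant for [B] of [e_(A_1) ^ ... ^ T(l) e_(A_k) ^ ... ^ e_(A_n)] along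
    row [k], the cofactor at [(k, j)] is, up to the sign [(-1)^(k+j)], the
    value at [Pr_k(A)] of the form dual to [Pr_j(B)], that is 1 if
    [Pr_k(A) = Pr_j(B)] and 0 otherwise. *)

Set Implicit Arguments.
Unset Strict Implicit.
Unset Printing Implicit Defensive.

Import Order.TTheory GRing.Theory.

Local Open Scope ring_scope.

(** * Bases and coordinates from a dual family of linear forms *)

Section BasisCriterion.
Context {f : fieldType} {V : lmodType f} {I : eqType}.
Implicit Types (e : I -> V) (v : V).

Lemma coef_basis e (He : is_basis e) i j : coef He (e i) j = (i == j)%:R.
Proof.
have ei : is_coords e (e i) (fun j => (i == j)%:R).
  exists [:: i]; split=> // [k|]; first by rewrite inE eq_sym => /negPf ->.
  by rewrite big_seq1 eqxx scale1r.
by rewrite (is_coords_uniq He.1 (coefP He (e i)) ei).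
Qed.

Variables (e : I -> V) (phi : I -> {linear V -> f^o}).
Hypothesis phi_dual : forall i j, phi i (e j) = (j == i)%:R.

Lemma dual_coords v c i : is_coords e v c -> phi i v = c i.
Proof.
move=> [s [us c0 ->]]; rewrite raddf_sum /=.
under eq_bigr => j _ do rewrite linearZ /= phi_dual.
have [si|/[dup] si /c0 ->] := boolP (i \in s).
  rewrite (bigD1_seq i) //= eqxx big1 ?addr0 => [|j /negPf ->].
    by rewrite [LHS]mulr1.
  exact: mulr0.
rewrite big_seq big1 // => j js; case: eqP => [ji|_]; last exact: mulr0.
by rewrite -ji js in si.
Qed.

Lemma dual_is_basis : generates e -> is_basis e.
Proof.
split=> // s c us s0 i si.
(* [is_coords] requires coefficients that vanish off [s], whereas [lin_indep] leaves [c] arbitrary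
   there. *)
pose c' j := if j \in s then c j else 0.
have c'0 : is_coords e 0 c'.
  exists s; split=> // [j /negPf sj|]; first by rewrite /c' sj.
  by rewrite -[LHS]s0 big_seq [RHS]big_seq; apply: eq_bigr => j sj; rewrite /c' sj.
by have := dual_coords i c'0; rewrite raddf0 /c' si.
Qed.

Lemma coef_dual (He : is_basis e) v i : coef He v i = phi i v.
Proof. exact/esym/dual_coords/coefP. Qed.

End BasisCriterion.

(** * Universal property of exterior powers, signs, and generators *)

Section Wedge.
Context {f : fieldType} {n : nat} {V : lmodType f}.
Implicit Types (t : {ffun 'I_n -> V}) (k l : 'I_n).

(** The linear extension of [F] to the free space on [V^n] factors through the two quotients in
    turn: multilinearity kills the first relations, alternation the second. *)
Lemma ext_power_universal (W : lmodType f) (F : {ffun 'I_n -> V} -> W) :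
  (forall t k a u v,
    F (upd t k (a *: u + v)) = a *: F (upd t k u) + F (upd t k v)) ->
  (forall t k l, k != l -> t k = t l -> F t = 0) ->
  exists phi : {linear ext_power n V -> W}, forall t, phi (wedge t) = F t.
Proof.
move=> Flin Falt.
have F0 x : multilin_rel x -> free_lift F x = 0.
  move=> [t [k [a [u [v ->]]]]]; rewrite !raddfB /= linearZ /= !free_liftU Flin.
  by rewrite -addrA -opprD subrr.
have qF t : qlift F0 (tensor t) = F t by rewrite qliftE /= free_liftU.
have F1 x : alternating_rel x -> qlift F0 x = 0.
  by move=> [t [k [l [kl tkl ->]]]]; rewrite qF (Falt _ _ _ kl tkl).
by exists (qlift F1) => t; rewrite [LHS]qliftE; apply: qF.
Qed.

(** Both sides are compatible with products of permutations, so that transpositions suffice; for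
    these, [wedge_swap] applies. *)
Lemma wedge_perm t (p : 'S_n) :
  wedge [ffun i => t (p i)] = (-1) ^+ p *: wedge t.
Proof.
have [ts -> _] := prod_tpermP p.
elim/big_ind: _ t => [t|q r IHq IHr t|[k l] _ t] /=.
- rewrite odd_perm1 scale1r; congr wedge.
  by apply/ffunP => i; rewrite ffunE perm1.
- rewrite odd_permM signr_addb -scalerA -IHr -IHq; congr wedge.
  by apply/ffunP => i; rewrite !ffunE permM.
- have [<-|kl] := eqVneq k l.
    rewrite tperm1 odd_perm1 scale1r; congr wedge.
    by apply/ffunP => i; rewrite ffunE perm1.
  rewrite odd_tperm kl scaleN1r; apply/eqP; rewrite -addr_eq0; apply/eqP.
  (* With these two vectors, the second term of [wedge_swap] is [wedge t] itself. *)
  rewrite -[RHS](wedge_swap t (t l) (t k) kl).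
  congr (wedge _ + wedge _); last by rewrite !upd_id.
  apply/ffunP => i; rewrite !ffunE.
  case: tpermP => [->|->|/eqP/negPf -> /eqP/negPf -> //].
    by rewrite (negPf kl) eqxx.
  by rewrite eqxx.
Qed.

Lemma wedge_upd0 t k : wedge (upd t k 0) = 0.
Proof. by have := wedgeP t k (-1) 0 0; rewrite scaler0 addr0 scaleN1r addNr. Qed.

Lemma wedge_span (S : ext_power n V -> Prop) (I : eqType) (e : I -> V) :
  generates e -> (forall s : 'I_n -> I, Defs.span S (wedge [ffun i => e (s i)])) ->
  forall t, Defs.span S (wedge t).
Proof.
move=> ge Se t.
(* The list [r] contains the positions that may not yet hold basis vectors; expanding the vector at
   one of them by multilinearity removes it from [r]. *)
suff : forall (r : seq 'I_n) t, (forall i, i \notin r -> exists j, t i = e j) ->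
    Defs.span S (wedge t).
  by move=> /(_ (enum 'I_n)); apply=> i; rewrite mem_enum.
elim=> [|k r IH] {}t te.
  have [s ts] := fin_all_exists (fun i => te i isT).
  by rewrite (_ : t = [ffun i => e (s i)]) //; apply/ffunP => i; rewrite ffunE.
rewrite -(upd_id t k); elim: (ge (t k)) => [|a _ u [j ->] _ Su].
  by rewrite wedge_upd0; apply: Defs.span0.
rewrite wedgeP; apply: span_add Su; apply: span_scale; apply: IH => i ir.
rewrite updE; case: eqVneq => [_|ik]; first by exists j.
by apply: te; rewrite inE negb_or ik.
Qed.

End Wedge.

(** * The basis of the exterior power and its dual forms *)

Section WedgeBasis.
Context {f : fieldType} {V : lmodType f} {d : Order.disp_t} {I : orderType d}.
Context {e : I -> V}.

(** A wedge of basis vectors is 0 if an index is repeated; otherwise sorting the indices changes it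
    by a sign only. *)
Lemma wedge_family_generates n : generates e -> generates (wedge_family (n := n) e).
Proof.
move=> ge; apply: ext_power_ind => [|a t x Sx]; first exact: Defs.span0.
apply: span_add Sx; apply: span_scale; move: t; apply: (wedge_span ge) => s.
have [/injectiveP s_inj|] := boolP (injectiveb s); last first.
  move=> /injectivePn[k [l kl skl]].
  by rewrite (wedge_alt kl) ?ffunE ?skl //; apply: Defs.span0.
pose t := [tuple s i | i < n].
have A_sorted : sorted <%O (sort_tuple <=%O t).
  rewrite lt_sorted_uniq_le sort_uniq (map_inj_uniq s_inj) enum_uniq.
  exact: sort_le_sorted.
pose A : ext_vertex I n := exist (fun B : n.-tuple I => sorted <%O B) _ A_sorted.
have /tuple_permP[p tE] : perm_eq t (sort_tuple <=%O t) by rewrite perm_sym perm_sort.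
have sE i : s i = entry A (p i).
  have /(congr1 (fun u : n.-tuple I => tnth u i)) :
    t = [tuple tnth (sort_tuple <=%O t) (p i) | i < n] by apply: val_inj.
  by rewrite !tnth_mktuple.
have -> : [ffun i => e (s i)] =
    [ffun i => [ffun j => e (entry A j)] (p i)] :> {ffun 'I_n -> V}.
  by apply/ffunP => i; rewrite !ffunE sE.
by rewrite wedge_perm; apply/span_scale/span_gen; exists A.
Qed.

(** For [A = B] this is the identity matrix. Otherwise some entry of [A] is missing from [B], since
    increasing sequences with the same entries are equal, and its row is zero. *)
Lemma det_entries n (A B : ext_vertex I n) :
  \det (\matrix_(i, j) (entry A i == entry B j)%:R) = (A == B)%:R :> f.
Proof.
have [<-|] := eqVneq A B.
  rewrite -[RHS](det1 f n); congr (\det _); apply/matrixP => i j.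
  by rewrite !mxE (inj_eq (@entry_inj _ _ _ _)).
have uA : uniq (val A) by apply: lt_sorted_uniq (valP A).
have [/allP AB|/allPn[x /tnthP[i ->] iB]] := boolP (all (mem (val B)) (val A)).
  have [|_ eqAB] := uniq_min_size uA AB; first by rewrite !size_tuple.
  case/eqP; do 2 apply: val_inj.
  exact: lt_sorted_eq (valP A) (valP B) eqAB.
rewrite (expand_det_row _ i) big1 // => j _; rewrite mxE.
case: eqP => [E|_]; last by rewrite mul0r.
by case/negP: iB; rewrite -/(entry A i) E; apply: mem_tnth.
Qed.

Context (He : is_basis e).

(** A Plücker coordinate: the maximal minor on the columns [A] of the coordinate matrix of [t]. *)
Definition coef_det n (t : {ffun 'I_n -> V}) (A : ext_vertex I n) : f :=
  \det (\matrix_(i, j) coef He (t i) (entry A j)).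

Lemma coef_det_dual n (A B : ext_vertex I n) :
  coef_det [ffun i => e (entry B i)] A = (B == A)%:R.
Proof.
rewrite -det_entries; congr (\det _).
by apply/matrixP => i j; rewrite !mxE ffunE coef_basis.
Qed.

Lemma coef_detP n (A : ext_vertex I n) : exists phi : {linear ext_power n V -> f^o},
  forall t, phi (wedge t) = coef_det t A.
Proof.
apply: ext_power_universal => [t k a u v|t k l kl tkl]; last first.
  by apply: (determinant_alternate kl) => j; rewrite !mxE tkl.
rewrite -[X in _ = _ + X]mul1r; apply: (@determinant_multilinear _ _ _ _ _ k).
- by apply/rowP => j; rewrite !mxE !updE eqxx coef_linear mul1r.
- by apply/matrixP => i j; rewrite !mxE !updE eq_sym (negPf (neq_lift _ _)).
- by apply/matrixP => i j; rewrite !mxE !updE eq_sym (negPf (neq_lift _ _)).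
Qed.

Lemma wedge_is_basis n : exists Hw : is_basis (wedge_family (n := n) e),
  forall t A, coef Hw (wedge t) A = coef_det t A.
Proof.
have [phi phiE] := choice (@coef_detP n).
have dual A B : phi A (wedge_family e B) = (B == A)%:R.
  by rewrite phiE coef_det_dual.
exists (dual_is_basis dual (wedge_family_generates He.2)) => t A.
by rewrite (coef_dual dual).
Qed.

Lemma coef_det_upd n (A B : ext_vertex I n) k v :
  coef_det (upd [ffun i => e (entry A i)] k v) B =
  \sum_(j < n) (-1) ^+ (k + j) * (erase k A == erase j B)%:R * coef He v (entry B j).
Proof.
rewrite /coef_det (expand_det_row _ k); apply: eq_bigr => j _.
rewrite mxE updE eqxx mulrC; congr (_ * _ * _); rewrite -det_entries.
congr (\det _); apply/matrixP => a b; rewrite !mxE updE eq_sym (negPf (neq_lift _ _)).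
by rewrite ffunE coef_basis !entry_erase.
Qed.

End WedgeBasis.

(** * Weights of the exterior graph and comparison with the diagram *)

Lemma scalar_sumE (f : fieldType) (L : lmodType f) (J : Type) (r : seq J)
  (P : pred J) (F : J -> {scalar L}) l :
  (\sum_(j <- r | P j) F j) l = \sum_(j <- r | P j) F j l.
Proof. exact: (big_morph (fun p : {scalar L} => p l)). Qed.

(** By [edgeE] the weights determine the edges. *)
Lemma wdigraph_eq (f : fieldType) (M : lmodType f) (X : Type) (G H : wdigraph M X) :
  weight G =2 weight H -> G = H.
Proof.
case: G H => [E w Ew] [E' w' Ew'] /= ww'.
have {}ww' : w = w' by apply/funext => x; apply/funext => y.
have EE' : E = E' by apply/funext => x; apply/funext => y; rewrite Ew Ew' ww'.
by subst w' E'; congr WDigraph; apply: Prop_irrelevance.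
Qed.

(** If [i != j], the [i]-th entry of [A] survives in [erase j A] but not in [erase i A]. *)
Lemma erase_eqr (d : Order.disp_t) (X : orderType d) n (A : ext_vertex X n) i j :
  (erase i A == erase j A) = (i == j).
Proof.
apply/eqP/eqP => [E|->//]; apply/eqP/negPn/negP => ij.
have := mem_erase A ij; rewrite -E => /tnthP[k].
by rewrite -/(entry _ k) entry_erase => /entry_inj/eqP; rewrite (negPf (neq_lift _ _)).
Qed.

Lemma signz_subn (R : unitRingType) (i j : nat) :
  (-1) ^ (j%:Z - i%:Z) = (-1) ^+ (i + j) :> R.
Proof.
by rewrite exprzDr ?unitrN1 // -exprz_inv invrN1 -exprD addnC.
Qed.

(** One formula for loops and other edges, in the shape of the row expansion [coef_det_upd]. For
    [A = B] only the terms with [i = j] survive, with sign 1; for [A != B] at most one pair has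
    equal erasures, by [erase_inj]. *)
Lemma ext_weightE (f : fieldType) (M : lmodType f) (d : Order.disp_t)
  (X : orderType d) n (G : wdigraph M X) (A B : ext_vertex X n) :
  ext_weight G A B = \sum_(i < n) \sum_(j < n)
    ((-1) ^+ (i + j) * (erase i A == erase j B)%:R) *: weight G (entry A i) (entry B j).
Proof.
rewrite /ext_weight; case: (eqVneq A B) => [<-|AB].
  apply: eq_bigr => i _; rewrite (bigD1 i) //= big1 => [|j].
    by rewrite eqxx addr0 mulr1 -signr_odd oddD addbb scale1r.
  by rewrite erase_eqr eq_sym => /negPf ->; rewrite mulr0 scale0r.
rewrite pair_bigA /=; case: pickP => [[i j] /andP[/= /eqP E _]|noadj].
  rewrite (bigD1 (i, j)) //= big1 => [|[i' j']].
    by rewrite E eqxx addr0 mulr1 signz_subn.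
  apply: contraNeq => /=; have [E'|] := eqVneq (erase i' A) (erase j' B).
    by have [-> ->] := erase_inj AB E E'.
  by rewrite mulr0 scale0r eqxx.
(* For a pair that is not adjacent, either the erasures differ or the weight in [G] is 0. *)
rewrite big1 // => -[i j] _ /=; have := noadj (i, j); rewrite /ext_adj /= edgeE.
case: (erase i A == erase j B) => /=; last by rewrite mulr0 scale0r.
by move=> /negbFE/eqP ->; rewrite scaler0.
Qed.

Theorem proposition8 (f : fieldType) (L : lieAlgType f) (V : lmodType f)
    (T : representation L V) (d : Order.disp_t) (I : orderType d)
    (e : I -> V) (He : is_basis e) (n : nat) :
  exists Hw : is_basis (wedge_family (n := n) e),
    ext_graph n (diagram He T) = diagram Hw (ext_rep T n).
Proof.
have [Hw coefE] := wedge_is_basis He n; exists Hw.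
apply: wdigraph_eq => A B; apply: scalar_ext => l.
rewrite /= ext_weightE scalar_sumE /= /diagram_weight ext_repE.
(* The [B]-coordinate is made a linear map so that it passes through the Leibniz sum over [k], whose
   terms then match the outer sum of [ext_weightE]. *)
pose c : ext_power n V -> f^o := fun x => coef Hw x B.
pose cL : {linear ext_power n V -> f^o} :=
  HB.pack c (GRing.isLinear.Build f _ f^o *:%R c (coef_linear Hw B)).
rewrite [RHS](raddf_sum cL); apply: eq_bigr => k _.
rewrite /= /c coefE coef_det_upd scalar_sumE ffunE.
exact: eq_bigr.
Qed.
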